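(* Let $x^*\in\Omega\cap\mathcal S$, and set $g(x):=T(x)$ and $h(x):=E(x^* )B(x)$ for $x\in\mathbb R^n$. The following statements are equivalent: (1) $E(x^* )\,\partial B(0)\subseteq\partial T(0)$; (2) $x^*$ is a global minimizer of $E$, i.e., $E(y)\ge E(x^* )$ for all $y\in\Omega$; (3) $0$ is a local minimizer of $g-h$ (on $\mathbb R^n$).
   Context: Standing assumptions: $T,B:\mathbb R^n\to\mathbb R$ are (finite-valued) convex functions with $T(\alpha x)=\alpha T(x)\ge 0$ and $B(\alpha x)=\alpha B(x)\ge 0$ for all $\alpha\ge 0$, $x\in\mathbb R^n$; moreover $\{x\in\mathbb R^n: B(x)=0\}\cap\{x\in\mathbb R^n: T(x)=0\}=\{0\}$ and $\Omega:=\{x\in\mathbb R^n: B(x)\ne 0\}$ is nonempty. For $x\in\Omega$, $E(x):=T(x)/B(x)$. $\|\cdot\|$ is the Euclidean norm, $\mathcal S:=\{x\in\mathbb R^n:\|x\|=1\}$, and $\partial$ denotes the convex subdifferential, $\partial f(x)=\{v: f(y)\ge f(x)+v^\top(y-x)\ \forall y\in\mathbb R^n\}$. *)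

(* Defs.v *)
From mathcomp Require Import all_boot all_order all_algebra.
From mathcomp Require Import all_classical all_reals all_analysis.

Set Implicit Arguments.
Unset Strict Implicit.
Unset Printing Implicit Defensive.

Import Order.TTheory GRing.Theory Num.Theory.
Import numFieldNormedType.Exports.

Local Open Scope classical_set_scope.
Local Open Scope ring_scope.

Definition dotv (R : realType) (n : nat) (u v : 'cV[R]_n) : R :=
  (u^T *m v) 0 0.

(* The norm `|x| that the library puts on matrices is the sup norm. *)
Definition enorm (R : realType) (n : nat) (x : 'cV[R]_n) : R :=
  Num.sqrt (dotv x x).

Definition usphere (R : realType) (n : nat) : set 'cV[R]_n :=
  [set x | enorm x = 1].

Definition nonneg_homogeneous (R : realType) (n : nat) (f : 'cV[R]_n -> R) :
    Prop :=
  forall (a : R) (x : 'cV[R]_n),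
    0 <= a -> f (a *: x) = a * f x /\ 0 <= a * f x.

Definition subdifferential (R : realType) (n : nat) (f : 'cV[R]_n -> R)
    (x : 'cV[R]_n) : set 'cV[R]_n :=
  [set v | forall y, f x + dotv v (y - x) <= f y].

Definition ratio_dom (R : realType) (n : nat) (B : 'cV[R]_n -> R) :
    set 'cV[R]_n :=
  [set x | B x != 0].

(* Meaningful on ratio_dom B only: elsewhere division by 0 returns 0. *)
Definition ratio_fun (R : realType) (n : nat) (T B : 'cV[R]_n -> R)
    (x : 'cV[R]_n) : R :=
  T x / B x.

Definition global_minimizer_on (R : realType) (n : nat) (D : set 'cV[R]_n)
    (f : 'cV[R]_n -> R) (x : 'cV[R]_n) : Prop :=
  D x /\ forall y, D y -> f x <= f y.

(* The library topology on 'cV[R]_n comes from the sup norm; it is the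
   Euclidean one. *)
Definition local_minimizer (R : realType) (n : nat) (f : 'cV[R]_n -> R)
    (x : 'cV[R]_n) : Prop :=
  \forall y \near x, f x <= f y.

(* Main.v *)
(** Let [c] be the value of [E] at the given point.  Where [B] vanishes,
    [T - c B = T >= 0], so (2) says that [T - c B >= 0] everywhere; this function
    is positively homogeneous, so that is equivalent to (3).  Since [v] is a
    subgradient of [B] at [0] iff [v . x <= B x] for all [x], it gives (1).
    Conversely, by the Hahn-Banach theorem [B] is the pointwise maximum of the
    linear functionals given by its subgradients at [0], so (1) gives
    [T - c B >= 0]. *)
Require Import Defs.
From mathcomp Require Import all_boot all_order all_algebra.
From mathcomp Require Import all_classical all_reals all_analysis.
From mathcomp Require Import lra.

Set Implicit Arguments.
Unset Strict Implicit.

Import Order.TTheory GRing.Theory Num.Theory.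
Import numFieldNormedType.Exports.

Local Open Scope classical_set_scope.
Local Open Scope ring_scope.

Definition sublinear (R : realType) (V : lmodType R) (p : V -> R) : Prop :=
  (forall x y, p (x + y) <= p x + p y) /\
  (forall (a : R) x, 0 <= a -> p (a *: x) = a * p x).

Lemma sublinear0 (R : realType) (V : lmodType R) (p : V -> R) :
  sublinear p -> p 0 = 0.
Proof. by case=> _ pZ; rewrite -(scale0r 0) pZ ?mul0r. Qed.

Lemma sublinear_oppr_ge (R : realType) (V : lmodType R) (p : V -> R) (x : V) :
  sublinear p -> - p x <= p (- x).
Proof.
move=> p_sub; have := p_sub.1 x (- x).
by rewrite subrr sublinear0// -lerBlDl sub0r.
Qed.

(* The largest sublinear minorant of [p] that is linear along [y] with value
   [p y] there is [x |-> inf_(t >= 0) (p (x + t y) - t p y)]. *)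
Lemma sublinear_minorant (R : realType) (V : lmodType R) (p : V -> R) (y : V) :
  sublinear p ->
  exists q : V -> R,
    [/\ sublinear q, forall x, q x <= p x & q (- y) <= - p y].
Proof.
move=> p_sub; have [pD pZ] := p_sub.
pose f x t := p (x + t *: y) - t * p y.
pose A x := [set f x t | t in [set t : R | 0 <= t]].
pose q x := inf (A x).
(* Without a lower bound uniform in [t], the infimum [q x] would be a mere default value. *)
have f_lb x t : 0 <= t -> - p (- x) <= f x t.
  move=> t0; rewrite /f -pZ// lerBrDr addrC lerBlDr.
  by have := pD (x + t *: y) (- x); rewrite addrAC subrr add0r.
have q_le x t : 0 <= t -> q x <= f x t.
  move=> t0; apply: ge_inf; last by exists t.
  by exists (- p (- x)) => _ [s s0 <-]; exact: f_lb.
have le_q x c : (forall t, 0 <= t -> c <= f x t) -> c <= q x.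
  move=> cf; apply: lb_le_inf; first by exists (f x 0), 0 => //=.
  by move=> _ [s s0 <-]; exact: cf.
(* Rescaling the parameter: [f (a *: x) (a * t) = a * f x t]. *)
have qZ_le (a : R) x : 0 < a -> q (a *: x) <= a * q x.
  move=> a0; rewrite -ler_pdivrMl//; apply: (le_q) => t t0.
  rewrite ler_pdivrMl//; apply: le_trans (q_le _ (a * t) _) _.
    by rewrite mulr_ge0// ltW.
  by rewrite /f -scalerA -scalerDr pZ ?(ltW a0)// mulrBr mulrA.
exists q; split.
- split=> [x x'|a x].
    (* The two infima are taken one after the other, since
       [f (x + x') (t + t') <= f x t + f x' t']. *)
    rewrite -lerBlDl; apply: (le_q) => t' t'0.
    rewrite lerBlDl -lerBlDr; apply: (le_q) => t t0.
    rewrite lerBlDr; apply: le_trans (q_le _ (t + t') _) _.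
      exact: addr_ge0.
    have := pD (x + t *: y) (x' + t' *: y).
    by rewrite addrACA -scalerDl /f; lra.
  rewrite le_eqVlt => /predU1P[<-|a0].
    rewrite scale0r mul0r; apply/eqP; rewrite eq_le; apply/andP; split.
      apply: le_trans (q_le _ 0 _) _ => //.
      by rewrite /f scale0r addr0 sublinear0 ?mul0r ?subr0.
    by apply: (le_q) => t t0; rewrite /f add0r pZ// subrr.
  apply/eqP; rewrite eq_le qZ_le//=.
  (* The reverse inequality is [qZ_le] for the inverse factor. *)
  have := qZ_le a^-1 (a *: x).
  by rewrite invr_gt0 scalerA mulVf ?gt_eqF// scale1r ler_pdivlMl//; apply.
- by move=> x; have := q_le x 0 (lexx 0); rewrite /f scale0r addr0 mul0r subr0.
- have := q_le (- y) 1 ler01.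
  by rewrite /f scale1r addNr sublinear0// mul1r sub0r.
Qed.

(** The minorants are taken successively along the vectors of [s]. What was gained for an earlier
    [y] survives in a smaller [r]: [r (- y) <= q (- y) <= - q y <= - r y]. For a finite list this
    replaces Zorn's lemma. *)
Lemma sublinear_minorant_seq (R : realType) (V : lmodType R) (p : V -> R)
    (s : seq V) :
  sublinear p ->
  exists q : V -> R,
    [/\ sublinear q, forall x, q x <= p x
      & forall y, y \in s -> q (- y) <= - q y].
Proof.
move=> p_sub; elim: s => [|z s [q [q_sub qp qN]]]; first by exists p; split.
have [r [r_sub rq rN]] := sublinear_minorant z q_sub.
exists r; split => // [x|y]; first exact: le_trans (rq x) (qp x).
rewrite inE => /predU1P[->|ys].
  by apply: le_trans rN _; rewrite lerN2.
by apply: le_trans (rq _) (le_trans (qN _ ys) _); rewrite lerN2.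
Qed.

Lemma sublinear_sum (R : realType) (V : lmodType R) (p : V -> R) (n : nat)
    (F : 'I_n -> V) :
  sublinear p -> p (\sum_i F i) <= \sum_i p (F i).
Proof.
move=> p_sub; apply: (big_ind2 (fun x a => p x <= a)) => [|x a y b xa yb|//].
  by rewrite sublinear0.
by apply: le_trans (p_sub.1 _ _) _; exact: lerD.
Qed.

Lemma dotvE (R : realType) (n : nat) (u v : 'cV[R]_n) :
  dotv u v = \sum_i u i 0 * v i 0.
Proof. by rewrite /dotv mxE; apply: eq_bigr => i _; rewrite mxE. Qed.

(** Hahn-Banach in finite dimension: a first minorant fixes the value at [y], and further ones along
    the standard basis make it linear; [v] collects its values on that basis. *)
Lemma sublinear_support (R : realType) (n : nat) (p : 'cV[R]_n -> R)
    (y : 'cV[R]_n) :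
  sublinear p ->
  exists v : 'cV[R]_n, (forall x, dotv v x <= p x) /\ dotv v y = p y.
Proof.
move=> p_sub.
have [p1 [p1_sub p1p p1y]] := sublinear_minorant y p_sub.
pose e (i : 'I_n) : 'cV[R]_n := delta_mx i 0.
have [q [q_sub qp1 qN]] := sublinear_minorant_seq (codom e) p1_sub.
have qeZ i a : q (a *: e i) <= a * q (e i).
  have [a0|/ltW a0] := leP 0 a; first by rewrite q_sub.2.
  (* For negative [a], write [a *: e i] as [(- a) *: (- e i)] and use [qN]. *)
  rewrite -[a *: _]opprK -scalerN -scaleNr q_sub.2 ?oppr_ge0//.
  by rewrite -[leRHS]mulrNN ler_wpM2l ?oppr_ge0// qN// codom_f.
exists (\col_i q (e i)); set v := \col_i _.
have q_le x : q x <= dotv v x.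
  rewrite {1}(matrix_sum_delta x) dotvE.
  rewrite (eq_bigr (fun i => x i 0 *: e i)); last by move=> i _; rewrite big_ord1.
  apply: le_trans (sublinear_sum _ _) _ => //; apply: ler_sum => i _.
  by rewrite mxE mulrC.
have dotvN x : dotv v (- x) = - dotv v x by rewrite /dotv mulmxN mxE.
have v_le x : dotv v x <= p x.
  apply: le_trans (le_trans (qp1 x) (p1p x)).
  (* [q_le] at [- x] gives [dotv v x <= - q (- x) <= q x], so [q] is in fact the functional of
     [v]. *)
  rewrite -[x in q x]opprK -[leLHS]opprK -dotvN.
  by apply: le_trans (sublinear_oppr_ge _ q_sub); rewrite lerN2.
split=> //; apply/eqP; rewrite eq_le v_le/=.
apply: le_trans (q_le y).
(* The chain is [p y <= - p1 (- y) <= - q (- y) <= q y]. *)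
have := sublinear_oppr_ge (- y) q_sub; rewrite opprK; apply: le_trans.
by rewrite lerNr; apply: le_trans (qp1 _) p1y.
Qed.

(** Subadditivity is convexity at the midpoint of [2 *: x] and [2 *: y], the factor 2 cancelling by
    homogeneity. *)
Lemma convex_homogeneous_sublinear (R : realType) (n : nat)
    (f : 'cV[R]_n -> R) :
  convex_function [set: 'cV[R]_n] f -> nonneg_homogeneous f -> sublinear f.
Proof.
move=> f_convex f_hom; split=> [x y|a x a0]; last by have [] := f_hom a x a0.
have h0 : 0 <= 2^-1 :> R by rewrite invr_ge0.
have h1 : 2^-1 <= 1 :> R by lra.
have fZ2 z : f (2 *: z) = 2 * f z by have [] := f_hom 2 z (ler0n _ 2).
have : f (2^-1 *: (2 *: x) + (1 - 2^-1) *: (2 *: y)) <=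
    2^-1 * f (2 *: x) + (1 - 2^-1) * f (2 *: y).
  exact: (f_convex (Itv01 h0 h1) (2 *: x) (2 *: y) (mem_set I) (mem_set I)).
have -> : 1 - 2^-1 = 2^-1 :> R by lra.
by rewrite !scalerA mulVf// !scale1r !fZ2 !mulKf.
Qed.

Lemma subdifferential0P (R : realType) (n : nat) (f : 'cV[R]_n -> R)
    (v : 'cV[R]_n) :
  f 0 = 0 -> subdifferential f 0 v <-> forall x, dotv v x <= f x.
Proof.
by move=> f0; split=> fv x; have := fv x; rewrite ?f0 ?add0r subr0.
Qed.

(** For small [t > 0] the point [t *: x] is close to 0, so [t * f x = f (t *: x) >= f 0 = 0]. *)
Lemma local_minimizer0_ge0 (R : realType) (n : nat) (f : 'cV[R]_n -> R) :
  (forall (a : R) x, 0 <= a -> f (a *: x) = a * f x) ->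
  local_minimizer f 0 -> forall x, 0 <= f x.
Proof.
move=> fZ f_min x.
have f0 : f 0 = 0 by rewrite -(scale0r 0) fZ ?mul0r.
have /nbhs_ballP[e /= e0 fe] : \forall t \near (0 : R), f 0 <= f (t *: x).
  have := @scalel_continuous _ _ x (0 : R).
  by rewrite /continuous_at scale0r; move=> /(_ _ f_min).
have e2 : 0 < e / 2 by rewrite divr_gt0.
have := fe (e / 2); rewrite /ball/= f0 fZ ?(ltW e2)// pmulr_rge0//; apply.
by rewrite sub0r normrN gtr0_norm// gtr_pMr// invf_lt1// ltr1n.
Qed.

Unset Implicit Arguments.
Set Strict Implicit.

Theorem theorem3p3 (R : realType) (n : nat) (T B : 'cV[R]_n -> R)
    (T_convex : convex_function [set: 'cV[R]_n] T)
    (B_convex : convex_function [set: 'cV[R]_n] B)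
    (T_homogeneous : nonneg_homogeneous T)
    (B_homogeneous : nonneg_homogeneous B)
    (TB_ker : [set x | B x = 0] `&` [set x | T x = 0] = [set 0])
    (dom_nonempty : ratio_dom B !=set0)
    (xs : 'cV[R]_n) (xs_in : (ratio_dom B `&` @usphere R n) xs) :
  let E := ratio_fun T B in
  let g := fun x : 'cV[R]_n => T x in
  let h := fun x : 'cV[R]_n => E xs * B x in
  [<-> [set E xs *: v | v in subdifferential B 0] `<=` subdifferential T 0;
       global_minimizer_on (ratio_dom B) E xs;
       local_minimizer (fun x => g x - h x) 0].
Proof.
move=> E g h.
have B_sub := convex_homogeneous_sublinear B_convex B_homogeneous.
have T_sub := convex_homogeneous_sublinear T_convex T_homogeneous.
have T0 := sublinear0 T_sub; have B0 := sublinear0 B_sub.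
have T_ge0 x : 0 <= T x by have [_] := T_homogeneous 1 x ler01; rewrite mul1r.
have B_ge0 x : 0 <= B x by have [_] := B_homogeneous 1 x ler01; rewrite mul1r.
have E_ge0 : 0 <= E xs by rewrite divr_ge0.
have dotvZ (a : R) (v x : 'cV[R]_n) : dotv (a *: v) x = a * dotv v x.
  by rewrite !dotvE mulr_sumr; apply: eq_bigr => i _; rewrite mxE mulrA.
tfae.
- move=> sub; split=> [|y By]; first exact: xs_in.1.
  (* A subgradient of [B] at 0 that attains [B y] turns the inclusion into [E xs * B y <= T y]. *)
  have [v [v_le vy]] := sublinear_support y B_sub.
  have /(subdifferential0P _ T0)/(_ y) : subdifferential T 0 (E xs *: v).
    by apply: sub; exists v => //; exact/subdifferential0P.
  by rewrite dotvZ vy /E/ratio_fun ler_pdivlMr// lt_neqAle eq_sym By B_ge0.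
- move=> [_ E_min]; near=> y.
  rewrite /g /h T0 B0 mulr0 subrr subr_ge0.
  (* Outside the domain [E_min] says nothing, and [T y >= 0] suffices. *)
  have [->|By] := eqVneq (B y) 0; first by rewrite mulr0.
  have := E_min y By.
  by rewrite [E y]/E/ratio_fun ler_pdivlMr// lt_neqAle eq_sym By B_ge0.
- move=> gh_min _ [v /(subdifferential0P _ B0) v_le <-].
  apply/subdifferential0P => // x; rewrite dotvZ.
  apply: le_trans (ler_wpM2l E_ge0 (v_le x)) _; rewrite -subr_ge0.
  apply: (@local_minimizer0_ge0 _ _ (fun x => g x - h x)) => // a z a0.
  by rewrite /g /h T_sub.2// B_sub.2// mulrBr mulrCA.
Unshelve. all: by end_near.
Qed.
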